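(* For every positive integer $k$, the $k$-th chain Whitney polynomial $M\mapsto W^k_M$ and the $k$-th chain Tutte polynomial $M\mapsto T^k_M$ are matroid valuations.
   Context: For a matroid $M$ on ground set $E$ with rank function $\mathrm{rk}$, the $k$-th chain Whitney polynomial is $$W^k_M((a_i)_1^k;(b_i)_1^k)=\sum_{S_1\subseteq\cdots\subseteq S_k\subseteq E}\ \prod_{i=1}^k a_i^{\mathrm{rk}(E)-\mathrm{rk}(S_i)}\,b_i^{|S_i|-\mathrm{rk}(S_i)}$$ (sum over all weakly increasing chains of $k$ subsets), and the $k$-th chain Tutte polynomial is $T^k_M((x_i);(y_i))=W^k_M((x_i-1);(y_i-1))$. The matroid polytope of $M$ is $P(M)=\mathrm{conv}\{e_B : B \text{ a basis of } M\}\subseteq\mathbb{R}^E$, where $e_B=\sum_{i\in B}e_i$. A matroid polyhedral subdivision of $P(M)$ is a collection $\{P(M_1),\dots,P(M_s)\}$ of matroid polytopes (matroids on $E$) with $P(M)=\bigcup_i P(M_i)$, all vertices being vertices of $P(M)$, and such that any nonempty intersection $P(M_i)\cap P(M_j)$, $i\neq j$, is a proper face of both (nonempty intersections of such pieces are again matroid polytopes). A function $f$ from matroids to a commutative ring is a matroid valuation if, for every such subdivision, $f(M)=\sum_{\emptyset\neq J\subseteq[s]}(-1)^{|J|-1}f\big(\bigcap_{j\in J}P(M_j)\big)$, where $f$ of a matroid polytope means $f$ of the corresponding matroid and $f(\emptyset)=0$. *)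

(* Defs.v *)
From mathcomp Require Import all_boot all_order all_algebra.
From mathcomp Require Import boolp classical_sets reals.
From mathcomp Require Import mpoly.

Set Implicit Arguments.
Unset Strict Implicit.
Unset Printing Implicit Defensive.

Import Order.TTheory GRing.Theory Num.Theory.

Local Open Scope classical_set_scope.
Local Open Scope ring_scope.

Record matroid (E : finType) := Matroid {
  bases : {set {set E}};
  bases_nonempty : (0 < #|bases|)%N;
  bases_exchange :
    [forall B1 in bases, forall B2 in bases, forall x in B1 :\: B2,
       exists y in B2 :\: B1, (y |: (B1 :\ x))%SET \in bases]
}.

Definition rk (E : finType) (M : matroid E) (S : {set E}) : nat :=
  (\max_(B in bases M) #|B :&: S|)%N.

Definition is_chain (E : finType) (k : nat) (S : {ffun 'I_k -> {set E}}) : bool :=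
  [forall i : 'I_k, forall j : 'I_k, (i <= j)%N ==> (S i \subset S j)].

(* The variables of {mpoly int[k + k]} are split as a_i = 'X_(lshift k i) and
   b_i = 'X_(rshift k i). The subtractions in the exponents are truncated, but
   rk S <= rk E and rk S <= #|S| always hold. *)
Definition chain_whitney (k : nat) (E : finType) (M : matroid E) :
    {mpoly int[k + k]} :=
  \sum_(S : {ffun 'I_k -> {set E}} | is_chain S)
    \prod_(i < k)
      ('X_(lshift k i) ^+ (rk M [set: E]%SET - rk M (S i))
       * 'X_(rshift k i) ^+ (#|S i| - rk M (S i))).

Definition chain_tutte (k : nat) (E : finType) (M : matroid E) :
    {mpoly int[k + k]} :=
  comp_mpoly [tuple ('X_i - 1 : {mpoly int[k + k]}) | i < k + k]
    (chain_whitney k M).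

Section Polytopes.
Variable R : realType.

(* The vector e_B in R^E. *)
Definition indicator (E : finType) (B : {set E}) : {ffun E -> R} :=
  [ffun i => (i \in B)%:R].

Definition matroid_polytope (E : finType) (M : matroid E) : set {ffun E -> R} :=
  [set x | exists w : {set E} -> R,
     [/\ forall B, B \in bases M -> 0 <= w B,
         \sum_(B in bases M) w B = 1
       & forall i, x i = \sum_(B in bases M) w B * indicator B i]].

Definition dotp (E : finType) (c x : {ffun E -> R}) : R := \sum_i c i * x i.

(* The set cut out of P by a valid linear inequality; this allows P itself
   and the empty set. *)
Definition is_face (E : finType) (F P : set {ffun E -> R}) : Prop :=
  exists (c : {ffun E -> R}) (b : R),
    (forall x, P x -> dotp c x <= b) /\ F = P `&` [set x | dotp c x = b].

Definition is_proper_face (E : finType) (F P : set {ffun E -> R}) : Prop :=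
  is_face F P /\ F <> P.

Definition is_vertex (E : finType) (v : {ffun E -> R})
    (P : set {ffun E -> R}) : Prop :=
  is_face [set v] P.

Definition is_matroid_subdivision (E : finType) (M : matroid E) (s : nat)
    (N : 'I_s -> matroid E) : Prop :=
  [/\ matroid_polytope M = \bigcup_i matroid_polytope (N i),
      forall i v, is_vertex v (matroid_polytope (N i)) ->
                  is_vertex v (matroid_polytope M)
    & forall i j, i <> j ->
        let F := matroid_polytope (N i) `&` matroid_polytope (N j) in
        F !=set0 ->
        is_proper_face F (matroid_polytope (N i)) /\
        is_proper_face F (matroid_polytope (N j))].

(* f read as a function of matroid polytopes, with value 0 on the empty set.
   The matroid is determined by its polytope: see matroid_polytope_inj. *)
Definition on_polytope (A : comPzRingType) (E : finType) (f : matroid E -> A)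
    (X : set {ffun E -> R}) : A :=
  if pselect (exists N, X = matroid_polytope N) is left h
  then f (projT1 (cid h)) else 0.

Definition is_matroid_valuation (A : comPzRingType)
    (f : forall E : finType, matroid E -> A) : Prop :=
  forall (E : finType) (M : matroid E) (s : nat) (N : 'I_s -> matroid E),
    is_matroid_subdivision M N ->
    f E M = \sum_(J : {set 'I_s} | (0 < #|J|)%N)
              (-1) ^+ (#|J| - 1) *
              on_polytope (f E) (\bigcap_(j in [set` J]) matroid_polytope (N j)).

Lemma matroid_eq (E : finType) (M N : matroid E) : bases M = bases N -> M = N.
Proof.
case: M N => [b p q] [b' p' q'] /= e; case: _ / e p' q' => p' q'.
by rewrite (bool_irrelevance p p') (bool_irrelevance q q').
Qed.

Lemma indicator_polytope (E : finType) (M : matroid E) (B : {set E}) :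
  matroid_polytope M (indicator B) <-> B \in bases M.
Proof.
split=> [[w [w0 w1 eB]]|BM]; last first.
  exists (fun C => (C == B)%:R); split=> [C _||]; first by rewrite ler0n.
    rewrite (bigD1 B) //= eqxx big1 ?addr0 // => C /andP[_ /negbTE->] //.
  move=> i; rewrite (bigD1 B) //= eqxx mul1r big1 ?addr0 // => C.
  by move=> /andP[_ /negbTE->]; rewrite mul0r.
have [C CM wC] : exists2 C, C \in bases M & w C != 0.
  apply: contrapT => h; move: w1; rewrite big1 => [/esym/eqP|C CM].
    by rewrite oner_eq0.
  by apply: contrapT => /eqP wC; apply: h; exists C.
have e i : \sum_(C in bases M) w C * (i \in C)%:R = (i \in B)%:R.
  by have := eB i; rewrite ffunE => ->; apply: eq_bigr => D _; rewrite ffunE.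
suff -> : B = C by [].
apply/setP => i; case: (boolP (i \in B)) => iB; apply/esym.
  have h : \sum_(D in bases M) w D * (1 - (i \in D)%:R) = 0.
    rewrite (eq_bigr (fun D => w D - w D * (i \in D)%:R)); last first.
      by move=> D _; rewrite mulrBr mulr1.
    by rewrite big_split /= sumrN w1 e iB subrr.
  have /psumr_eq0P /(_ h C CM)/eqP : forall D, D \in bases M ->
      0 <= w D * (1 - (i \in D)%:R).
    by move=> D DM; rewrite mulr_ge0 ?w0 // subr_ge0 lern1 leq_b1.
  rewrite mulf_eq0 (negbTE wC) /= subr_eq0.
  by case: (i \in C) => //; rewrite oner_eq0.
have h := e i; rewrite (negbTE iB) in h.
have /psumr_eq0P /(_ h C CM)/eqP : forall D, D \in bases M ->
    0 <= w D * (i \in D)%:R.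
  by move=> D DM; rewrite mulr_ge0 ?w0 // ler0n.
by rewrite mulf_eq0 (negbTE wC) /= pnatr_eq0 eqb0 => /negbTE.
Qed.

Lemma matroid_polytope_inj (E : finType) : injective (@matroid_polytope E).
Proof.
move=> M N eMN; apply: matroid_eq; apply/setP => B.
by apply/idP/idP => /indicator_polytope h; apply/indicator_polytope;
  [rewrite -eMN | rewrite eMN].
Qed.

Lemma on_polytopeE (A : comPzRingType) (E : finType) (f : matroid E -> A)
  (M : matroid E) : on_polytope f (matroid_polytope M) = f M.
Proof.
rewrite /on_polytope; case: pselect => [h|[]]; last by exists M.
by case: (cid h) => N /= /matroid_polytope_inj ->.
Qed.

Lemma on_polytope0 (A : comPzRingType) (E : finType) (f : matroid E -> A) :
  on_polytope f set0 = 0.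
Proof.
rewrite /on_polytope; case: pselect => // -[N h]; exfalso.
have /card_gt0P[B BN] := bases_nonempty N.
by have /indicator_polytope := BN; rewrite -h.
Qed.

End Polytopes.

(* Main.v *)
(* For a chain S_1 <= ... <= S_k, augmentation gives a basis of M attaining all
   the ranks rk (S_i) at once, so P(M) meets { x : x(S_i) >= rho_i for all i }
   iff rho_i <= rk (S_i) for all i. Telescoping the monomials of the Whitney
   polynomial writes it as a linear combination of the indicators of these
   conditions. Whether a polyhedron meets a fixed polyhedron is a valuation:
   inclusion-exclusion gives a linear relation between indicator functions, and
   projecting along one coordinate at a time (where the fibres are closed
   intervals) preserves it. Nonempty intersections of pieces are faces of
   matroid polytopes, hence matroid polytopes by symmetric basis exchange.
   The Tutte polynomial is the image of the Whitney polynomial under a ring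
   morphism. *)
Require Import Defs.
From mathcomp Require Import all_boot all_order all_algebra.
From mathcomp Require Import boolp classical_sets reals.
From mathcomp Require Import mpoly.
From mathcomp Require Import lra.

Set Implicit Arguments.
Unset Strict Implicit.
Unset Printing Implicit Defensive.

Import Order.TTheory GRing.Theory Num.Theory.

(** * Bases, independent sets and ranks in a matroid *)

Section MatroidTheory.
Import mathcomp.boot.fintype mathcomp.boot.finset.
Variables (E : finType) (M : matroid E).
Implicit Types (A B C I J S : {set E}).

Lemma basis_exchange B1 B2 x : B1 \in bases M -> B2 \in bases M ->
  x \in B1 :\: B2 ->
  exists2 y, y \in B2 :\: B1 & y |: (B1 :\ x) \in bases M.
Proof.
move=> h1 h2 hx; have /forall_inP/(_ _ h1)/forall_inP/(_ _ h2) := bases_exchange M.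
by move=> /forall_inP/(_ _ hx)/exists_inP.
Qed.

Lemma card_exchange B x y : x \in B -> y \notin B -> #|y |: (B :\ x)| = #|B|.
Proof.
by move=> xB yB; rewrite cardsU1 (cardsD1 x B) xB !inE (negbTE yB) andbF.
Qed.

(** Exchanging an element of [B1 :\: B2] for one of [B2] keeps the size of [B1] and shrinks
    [B1 :\: B2], until [B1] lies inside [B2]. *)
Lemma card_basis_leq B1 B2 :
  B1 \in bases M -> B2 \in bases M -> (#|B1| <= #|B2|)%N.
Proof.
have [n] := ubnP #|B1 :\: B2|; elim: n B1 => // n IH B1 le_n h1 h2.
have [B12|[x hx]] := set_0Vmem (B1 :\: B2).
  by apply: subset_leq_card; rewrite -setD_eq0 B12.
have [y hy hB] := basis_exchange h1 h2 hx.
move: (hx) (hy); rewrite !inE => /andP[xB2 xB1] /andP[yB1 yB2].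
rewrite -(card_exchange xB1 yB1); apply: IH => //.
rewrite -ltnS (leq_trans _ le_n) // ltnS (cardsD1 x (B1 :\: B2)) hx.
rewrite ltnS; apply/subset_leq_card/subsetP => z; rewrite !inE.
case/andP=> zB2 /orP[/eqP zy|]; first by rewrite zy yB2 in zB2.
by case/andP=> -> ->; rewrite zB2.
Qed.

Lemma card_basis B1 B2 : B1 \in bases M -> B2 \in bases M -> #|B1| = #|B2|.
Proof. by move=> h1 h2; apply/eqP; rewrite eqn_leq !card_basis_leq. Qed.

Definition indep I := [exists B in bases M, I \subset B].

Lemma indepP I : reflect (exists2 B, B \in bases M & I \subset B) (indep I).
Proof. exact: exists_inP. Qed.

Lemma indepS I J : I \subset J -> indep J -> indep I.
Proof.
by move=> IJ /indepP[B BM JB]; apply/indepP; exists B => //; apply: subset_trans JB.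
Qed.

Lemma basis_indep B : B \in bases M -> indep B.
Proof. by move=> BM; apply/indepP; exists B. Qed.

Lemma indep_basis I B : B \in bases M -> indep I -> (#|B| <= #|I|)%N ->
  I \in bases M.
Proof.
move=> BM /indepP[C CM IC] le_BI; suff -> : I = C by [].
by apply/eqP; rewrite eqEcard IC (card_basis CM BM).
Qed.

(* Take [B2] as close to [J :|: B1] as possible: then [B2 :\: B1] lies in
   [J], and exchanging an element of [B1 :\: (B2 :|: I)] would produce the
   required basis. *)
Lemma augmentation I J : indep I -> indep J -> (#|I| < #|J|)%N ->
  exists2 e, e \in J :\: I & indep (e |: I).
Proof.
move=> /indepP[B1 h1 IB1] /indepP[B0 h0 JB0] ltIJ.
have [|/exists_inPn no_e] := boolP [exists e in J :\: I, indep (e |: I)].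
  by move=> /exists_inP.
exfalso; pose P B := (B \in bases M) && (J \subset B).
have P0 : P B0 by rewrite /P h0.
case: (@arg_minnP _ B0 P (fun B => #|B :\: (J :|: B1)|) P0).
move=> B2 /andP[h2 JB2] B2min.
have JI e : e \in J -> e \notin I -> e \notin B1.
  move=> eJ eI; apply/negP => eB1.
  have /no_e/negP[] : e \in J :\: I by rewrite inE eI.
  by apply/indepP; exists B1; rewrite // subUset sub1set eB1.
have sB2 x : x \in B2 -> x \notin B1 -> x \in J.
  move=> xB2 xB1; apply/negPn/negP => xJ.
  have hx : x \in B2 :\: B1 by rewrite inE xB1.
  have [y] := basis_exchange h2 h1 hx; rewrite inE => /andP[yB2 yB1] hB.
  have := B2min (y |: (B2 :\ x)); rewrite /P hB subsetU /= ?subsetD1 ?JB2 ?xJ ?orbT //.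
  move=> /(_ isT); apply/negP; rewrite -ltnNge.
  apply/proper_card/properP; split.
    apply/subsetP => z; rewrite !inE => /andP[zJB /orP[/eqP zy|/andP[_ zB2]]].
      by rewrite zy yB1 orbT in zJB.
    by rewrite zJB.
  exists x; rewrite !inE ?xB2 (negbTE xJ) (negbTE xB1) //= eqxx /= orbF.
    by apply: contraNneq yB2 => <-.
have sB1 x : x \in B1 -> x \notin B2 -> x \in I.
  move=> xB1 xB2; apply/negPn/negP => xI.
  have hx : x \in B1 :\: B2 by rewrite inE xB2.
  have [y] := basis_exchange h1 h2 hx; rewrite inE => /andP[yB1 yB2] hB.
  have yJ := sB2 y yB2 yB1.
  have /no_e/negP[] : y \in J :\: I.
    by rewrite inE yJ andbT; apply: contra yB1 => /(subsetP IB1).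
  apply/indepP; exists (y |: (B1 :\ x)) => //.
  by apply: setUS; rewrite subsetD1 IB1.
(* [J :\: I] lies in [B2 :\: B1], and [B1 :\: B2] lies in [I :\: J]. The two differences of bases
   have equal size, which contradicts [#|I| < #|J|]. *)
have : (#|J :\: I| <= #|I :\: J|)%N.
  apply: (@leq_trans #|B2 :\: B1|).
    apply/subset_leq_card/subsetP => e; rewrite !inE => /andP[eI eJ].
    by rewrite (JI e eJ eI) (subsetP JB2).
  have -> : #|B2 :\: B1| = #|B1 :\: B2|.
    by rewrite !cardsD (card_basis h1 h2) setIC.
  apply/subset_leq_card/subsetP => e; rewrite !inE => /andP[eB2 eB1].
  by rewrite (sB1 e eB1 eB2) andbT; apply: contra eB2 => /(subsetP JB2).
rewrite leqNgt; have := cardsID J I; have := cardsID I J.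
by rewrite setIC => eJ eI; rewrite -eJ -eI ltn_add2l in ltIJ; rewrite ltIJ.
Qed.

Lemma indep_extend I J : indep I -> indep J -> (#|I| <= #|J|)%N ->
  exists K, [/\ indep K, I \subset K, K \subset I :|: J & #|K| = #|J|].
Proof.
move=> hI hJ; have [n] := ubnP (#|J| - #|I|)%N.
elim: n I hI => // n IH I hI le_n leIJ.
have [eIJ|neIJ] := eqVneq #|I| #|J|.
  by exists I; rewrite subxx subsetUl.
have ltIJ : (#|I| < #|J|)%N by rewrite ltn_neqAle neIJ.
have [e] := augmentation hI hJ ltIJ; rewrite inE => /andP[eI eJ] hIe.
have cIe : #|e |: I| = #|I|.+1 by rewrite cardsU1 eI.
have [||K [hK sK Ks cK]] := IH _ hIe.
- by rewrite cIe -ltnS (leq_trans _ le_n) // !ltnS ltn_sub2l.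
- by rewrite cIe.
exists K; split=> //; first by apply: subset_trans sK; apply: subsetUr.
apply: subset_trans Ks _; rewrite !subUset sub1set inE eJ orbT.
by rewrite subsetUl subsetUr.
Qed.

(* [C], the set of the [y] that may leave [B2] in exchange for [x], is the
   fundamental circuit of [x] with [x] removed. If no element of [C] could
   replace [x] in [B1], then [B1 :\ x] would be maximal independent in
   [C :|: B1 :\ x], which forces [x |: C] to be independent. *)
Lemma symmetric_exchange B1 B2 x : B1 \in bases M -> B2 \in bases M ->
  x \in B1 :\: B2 ->
  exists y, [/\ y \in B2 :\: B1, y |: (B1 :\ x) \in bases M &
                x |: (B2 :\ y) \in bases M].
Proof.
move=> h1 h2; rewrite inE => /andP[xB2 xB1].
pose C := [set y in B2 | x |: (B2 :\ y) \in bases M].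
have CB2 : C \subset B2 by apply/subsetP => y; rewrite inE => /andP[].
have hC : indep C by apply: indepS (basis_indep h2).
have xC : x \notin C by apply: contra xB2 => /(subsetP CB2).
have cA : #|B1 :\ x|.+1 = #|B1| by rewrite (cardsD1 x B1) xB1.
have CxD : ~~ indep (x |: C).
  apply/negP => hCx.
  have leCB : (#|x |: C| <= #|B2|)%N.
    have /indepP[B BM sB] := hCx.
    by rewrite -(card_basis BM h2) subset_leq_card.
  (* [K] is a basis inside [x |: B2], so it arises from [B2] by trading some [y] for [x]. Then [y]
     is in [C], hence in [K], a contradiction. *)
  have [K [hK sK Ks cK]] := indep_extend hCx (basis_indep h2) leCB.
  have xK : x \in K by apply: (subsetP sK); rewrite setU11.
  have KxB2 : K :\ x \subset B2.
    apply/subsetP => z; rewrite !inE => /andP[zx /(subsetP Ks)].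
    rewrite !inE (negbTE zx) /=.
    by case/orP=> [/andP[]|].
  have cKx : #|K :\ x|.+1 = #|B2| by rewrite -cK (cardsD1 x K) xK.
  have : K :\ x \proper B2 by rewrite properEcard KxB2 -cKx ltnS leqnn.
  move=> /properP[_ [y yB2 yK]].
  have eK : K :\ x = B2 :\ y.
    apply/eqP; rewrite eqEcard; apply/andP; split.
      by rewrite subsetD1 KxB2.
    by rewrite -ltnS cKx (cardsD1 y B2) yB2.
  have yC : y \in C.
    rewrite inE yB2 -eK (setD1K xK).
    by apply: (indep_basis h2 hK); rewrite cK.
  move: yK; rewrite !inE negb_and negbK => /orP[/eqP yx|].
    by rewrite -yx yB2 in xB2.
  by rewrite (subsetP sK) // inE yC orbT.
have [/exists_inP[y]|/exists_inPn no_y] :=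
    boolP [exists y in C :\: B1, indep (y |: (B1 :\ x))].
  rewrite !inE => /andP[yB1 /andP[yB2 hB]] hA; exists y; split=> //.
    by rewrite inE yB1.
  by apply: (indep_basis h1 hA); rewrite card_exchange.
exfalso.
have maxA I : indep I -> I \subset C :|: (B1 :\ x) -> (#|I| < #|B1|)%N.
  move=> hI sI; rewrite ltnNge; apply/negP => leI.
  have hA : indep (B1 :\ x) by apply: indepS (basis_indep h1); apply: subsetDl.
  have [|e] := augmentation hA hI; first by rewrite cA.
  rewrite inE => /andP[eA eI] hAe.
  have /setUP[eC|eA'] := subsetP sI e eI; last by rewrite eA' in eA.
  have ex : e != x by apply: contraNneq xC => <-.
  have /no_y/negP[] // : e \in C :\: B1.
  by rewrite inE eC andbT; move: eA; rewrite !inE ex.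
pose P I := [&& indep I, C \subset I & I \subset C :|: (B1 :\ x)].
have PC : P C by rewrite /P hC subxx subsetUl.
case: (@arg_maxnP _ C P (fun I => #|I|) PC) => I /and3P[hI CI sI] Imax.
(* By maximality of [I], the element gained from [B1] can only be [x], which makes [x |: C]
   independent. *)
have [e] := augmentation hI (basis_indep h1) (maxA I hI sI).
rewrite inE => /andP[eI eB1] hIe.
have [ex|ex] := eqVneq e x.
  by case/negP: CxD; apply: indepS hIe; rewrite ex setUS.
have /Imax : P (e |: I).
  rewrite /P hIe (subset_trans CI) ?subsetUr //= subUset sI andbT sub1set.
  by rewrite !inE ex eB1 orbT.
by rewrite cardsU1 eI add1n /= ltnn.
Qed.

Lemma rk_leq S B : B \in bases M -> (#|B :&: S| <= rk M S)%N.
Proof. by move=> BM; rewrite /rk (bigD1 B) //= leq_maxl. Qed.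

Lemma rk_witness S : exists2 B, B \in bases M & rk M S = #|B :&: S|.
Proof.
have /card_gt0P[B0 h0] := bases_nonempty M.
have [B BM] := @eq_bigmax_cond _ (mem (bases M)) (fun B => #|B :&: S|)
  (bases_nonempty M).
by exists B.
Qed.

Lemma rk_setT B : B \in bases M -> rk M [set: E] = #|B|.
Proof.
by move=> BM; have [C CM ->] := rk_witness [set: E]; rewrite setIT (card_basis CM BM).
Qed.

Lemma rk_card S : (rk M S <= #|S|)%N.
Proof.
by have [B _ ->] := rk_witness S; apply/subset_leq_card/subsetIr.
Qed.

Lemma indep_rk_extend I S : indep I -> I \subset S ->
  exists K, [/\ indep K, I \subset K, K \subset S & #|K| = rk M S].
Proof.
move=> hI IS; have [B BM eB] := rk_witness S.
have hBS : indep (B :&: S) by apply: indepS (basis_indep BM); apply: subsetIl.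
have [|K [hK sK Ks cK]] := indep_extend hI hBS.
  rewrite -eB; have /indepP[C CM IC] := hI; apply: leq_trans (rk_leq S CM).
  by apply: subset_leq_card; rewrite subsetI IC.
exists K; split=> //; last by rewrite cK eB.
by apply: subset_trans Ks _; rewrite subUset IS subsetIr.
Qed.

(** An independent set grows along the chain, filled up to full rank inside each set before moving
    to the next. Any basis containing the result attains every rank. *)
Lemma chain_basis k (S : {ffun 'I_k -> {set E}}) : is_chain S ->
  exists2 B, B \in bases M & forall i, #|B :&: S i| = rk M (S i).
Proof.
move=> /forallP Schain.
have Smono (i j : 'I_k) : (i <= j)%N -> S i \subset S j.
  by move=> ij; have /forallP/(_ j)/implyP/(_ ij) := Schain i.
(* After [m] stages [I] must still lie inside every later set, so that the next extension can take
   place within [S m]. *)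
suff /(_ k (leqnn k)) [I [hI _ rI]] : forall m, (m <= k)%N -> exists I,
    [/\ indep I, (forall i : 'I_k, (m <= i)%N -> I \subset S i) &
        forall i : 'I_k, (i < m)%N -> (rk M (S i) <= #|I :&: S i|)%N].
  have /indepP[B BM IB] := hI; exists B => // i.
  apply/eqP; rewrite eqn_leq rk_leq //= (leq_trans (rI i (ltn_ord i))) //.
  by apply/subset_leq_card/setSI.
elim=> [_|m IH ltmk].
  exists set0; split=> // [|i _]; last exact: sub0set.
  have /card_gt0P[B BM] := bases_nonempty M.
  by apply/indepP; exists B; rewrite ?sub0set.
have [I [hI sI rI]] := IH (ltnW ltmk).
have [K [hK IK KS cK]] := indep_rk_extend hI (sI (Ordinal ltmk) (leqnn m)).
exists K; split=> // i.
  by move=> lemi; apply: subset_trans KS (Smono _ _ _); apply: ltnW.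
rewrite ltnS leq_eqVlt => /orP[/eqP im|lti].
  have -> : i = Ordinal ltmk by apply: val_inj.
  by rewrite (setIidPl KS) cK.
by apply: leq_trans (rI i lti) _; apply/subset_leq_card/setSI.
Qed.

End MatroidTheory.

Local Open Scope ring_scope.

(** * Linear inequalities in one variable and the Euler relation for closed intervals *)

Section Intervals.
Variable R : realFieldType.

Lemma seq_max_or_nil (L : seq R) :
  L = [::] \/ exists2 m, m \in L & forall l, l \in L -> l <= m.
Proof.
elim: L => [|a L [->|[m mL mmax]]]; [by left|right|right].
  by exists a => [|l]; rewrite inE // => /eqP->.
case: (lerP a m) => am.
  exists m => [|l]; first by rewrite inE mL orbT.
  by rewrite inE => /orP[/eqP->//|/mmax].
exists a => [|l]; first by rewrite inE eqxx.
by rewrite inE => /orP[/eqP->//|/mmax lm]; rewrite (le_trans lm) ?ltW.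
Qed.

Lemma exists_between (L U : seq R) :
  (forall l u, l \in L -> u \in U -> l <= u) ->
  exists s, (forall l, l \in L -> l <= s) /\ (forall u, u \in U -> s <= u).
Proof.
move=> LU; case: (seq_max_or_nil L) => [->|[m mL mmax]]; last first.
  by exists m; split=> // u uU; apply: LU.
have [U0|[m mU mmax]] := seq_max_or_nil [seq - u | u <- U].
  by case: U LU U0 => // _ _; exists 0.
exists (- m); split=> // u uU; rewrite lerNl; apply: mmax.
by apply/mapP; exists u.
Qed.

(** Negative slopes give lower bounds on [d] and positive slopes upper bounds. A solution exists iff
    each lower bound is at most each upper bound, written here with denominators cleared. *)
Lemma fourier_motzkin1 (cs : seq (R * R)) :
  (exists d, all (fun c => c.1 * d + c.2 <= 0) cs) <->
  (forall c, c \in cs -> c.1 = 0 -> c.2 <= 0) /\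
  (forall p q, p \in cs -> q \in cs -> 0 < p.1 -> q.1 < 0 ->
     p.1 * q.2 - q.1 * p.2 <= 0).
Proof.
split=> [[d /allP h]|[h0 hpq]].
  split=> [c /h + c0|p q /h + /h]; first by rewrite c0 mul0r add0r.
  by move=> *; nra.
pose L := [seq - c.2 / c.1 | c <- cs & c.1 < 0].
pose U := [seq - c.2 / c.1 | c <- cs & 0 < c.1].
have [l u|d [dL dU]] := @exists_between L U.
  move=> /mapP[q]; rewrite mem_filter => /andP[q0 qcs] ->.
  move=> /mapP[p]; rewrite mem_filter => /andP[p0 pcs] ->.
  rewrite ler_ndivrMr // mulrAC ler_pdivrMr //.
  by have := hpq p q pcs qcs p0 q0; lra.
exists d; apply/allP => c ccs; case: (ltrgtP c.1 0) => c0.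
- have : - c.2 / c.1 <= d.
    by apply: dL; apply/mapP; exists c; rewrite // mem_filter c0.
  by rewrite ler_ndivrMr //; lra.
- have : d <= - c.2 / c.1.
    by apply: dU; apply/mapP; exists c; rewrite // mem_filter c0.
  by rewrite ler_pdivlMr //; lra.
- by rewrite c0 mul0r add0r h0.
Qed.

(** Clipping to a bounded range gives the solution set two finite ends even when the constraints
    leave it unbounded; [l > u] encodes the empty set. *)
Lemma clipped_interval (a b : R) (cs : seq (R * R)) :
  exists l u, forall d, (l <= d <= u) =
    (a <= d <= b) && all (fun c => c.1 * d + c.2 <= 0) cs.
Proof.
elim: cs => [|c cs [l [u lu]]]; first by exists a, b => d; rewrite andbT.
case: (ltrgtP c.1 0) => c0.
- exists (Num.max l (- c.2 / c.1)), u => d /=.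
  rewrite ge_max andbAC lu ler_ndivrMr // -andbA [X in _ && X]andbC.
  by congr (_ && (_ && _)); apply/idP/idP => ?; lra.
- exists l, (Num.min u (- c.2 / c.1)) => d /=.
  rewrite le_min andbA lu ler_pdivlMr // -andbA [X in _ && X]andbC.
  by congr (_ && (_ && _)); apply/idP/idP => ?; lra.
- case: (lerP c.2 0) => c2.
    by exists l, u => d /=; rewrite c0 mul0r add0r c2 lu.
  (* A constant constraint that fails: the ends 1 and 0 encode the empty interval. *)
  exists 1, 0 => d /=; rewrite c0 mul0r add0r (lt_geF c2) andbF.
  by apply/idP; lra.
Qed.

Section FiniteFamily.
Variables (T : finType) (V : zmodType).

Lemma exists_small (F : T -> R) :
  (forall t, 0 < F t) -> exists2 e, 0 < e & forall t, e < F t.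
Proof.
move=> F0; suff [e e0 he] : exists2 e, 0 < e & forall t, t \in enum T -> e < F t.
  by exists e => // t; apply: he; rewrite mem_enum.
elim: (enum T) => [|t s [e e0 he]]; first by exists 1.
exists (Num.min e (F t / 2)) => [|t']; first by rewrite lt_min e0 divr_gt0.
rewrite inE gt_min => /orP[/eqP->|/he->//].
by apply/orP; right; have := F0 t; lra.
Qed.

(* Subtract the relation at [s + e], for small [e > 0], from the one at [s]. *)
Lemma interval_upper_end (a : T -> V) (l u : T -> R) :
  (forall s, \sum_t a t *+ (l t <= s <= u t)%R = 0) ->
  forall s, \sum_t a t *+ ((l t <= u t)%R && (u t == s)) = 0.
Proof.
(* With [e] below every gap, no end lies in (s, s + e]. So an interval containing [s + e] contains
   [s], and one containing [s] misses [s + e] exactly when it ends at [s]. *)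
move=> h s; pose gap z := if s < z then z - s else 1.
have gap0 z : 0 < gap z by rewrite /gap; case: ifP; lra.
have [e e0 he] : exists2 e, 0 < e & forall t, e < Num.min (gap (l t)) (gap (u t)).
  by apply: exists_small => t; rewrite lt_min !gap0.
rewrite -[RHS](subrr 0) -[in X in X - _](h s) -[in X in _ - X](h (s + e)).
rewrite -sumrB; apply: eq_bigr => t _.
have := he t; rewrite lt_min /gap => /andP[].
case: (ltrP s (l t)) => sl; case: (ltrgtP s (u t)) => su el eu;
  rewrite ?andbT ?andbF /=.
all: try (have -> : (s + e <= u t) = true by lra).
all: try (have -> : (s + e <= u t) = false by apply/negbTE; rewrite -ltNge; lra).
all: try (have -> : (l t <= s + e) = true by lra).
all: try (have -> : (l t <= s + e) = false by apply/negbTE; rewrite -ltNge; lra).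
all: rewrite ?andbT ?andbF /= ?subrr ?subr0 //.
all: try by have -> : (l t <= u t) = false by apply/negbTE; rewrite -ltNge; lra.
by have -> : (l t <= u t) = true by lra.
Qed.

(** A nonempty interval has exactly one upper end, so summing [interval_upper_end] over the finitely
    many upper ends counts each such interval once. *)
Lemma interval_euler (a : T -> V) (l u : T -> R) :
  (forall s, \sum_t a t *+ (l t <= s <= u t)%R = 0) ->
  \sum_t a t *+ (l t <= u t)%R = 0.
Proof.
move=> h; pose us := undup [seq u t | t : T].
rewrite (eq_bigr (fun t => \sum_(s <- us) a t *+ ((l t <= u t)%R && (u t == s)))).
  by rewrite exchange_big big1_seq // => s _; apply: interval_upper_end.
move=> t _; rewrite (bigD1_seq (u t)) ?undup_uniq //=; last first.
  by rewrite mem_undup; apply/mapP; exists t; rewrite ?mem_enum.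
rewrite eqxx andbT big1 ?addr0 // => s /negbTE.
by rewrite eq_sym => ->; rewrite andbF mulr0n.
Qed.

End FiniteFamily.
End Intervals.

(** * Polyhedra, their coordinate projections and the Euler relation under projection *)

Section Polyhedra.
Variables (R : realFieldType) (I : finType).
Implicit Types (x : I -> R) (f g : (I -> R) -> R) (P Q : (I -> R) -> Prop).

Definition aff (c : (I -> R) * R) x : R := \sum_i c.1 i * x i + c.2.

Definition affine f := exists c, forall x, f x = aff c x.

Definition polyhedral P :=
  exists cs, forall x, P x <-> all (fun c => aff c x <= 0) cs.

Definition upd x i s : I -> R := fun j => if j == i then s else x j.

Lemma affine_cst a : affine (fun=> a).
Proof.
by exists (fun=> 0, a) => x; rewrite /aff big1 ?add0r // => i _; rewrite mul0r.
Qed.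

Lemma affine_coord i : affine (fun x => x i).
Proof.
exists (fun j => (j == i)%:R, 0) => x.
rewrite /aff addr0 (bigD1 i) //= eqxx mul1r big1 ?addr0 // => j /negbTE->.
by rewrite mul0r.
Qed.

Lemma affineD f g : affine f -> affine g -> affine (fun x => f x + g x).
Proof.
move=> [c hc] [d hd]; exists (fun i => c.1 i + d.1 i, c.2 + d.2) => x.
rewrite hc hd /aff /= addrACA -big_split; congr (_ + _).
by apply: eq_bigr => i _; rewrite mulrDl.
Qed.

Lemma affineZ a f : affine f -> affine (fun x => a * f x).
Proof.
move=> [c hc]; exists (fun i => a * c.1 i, a * c.2) => x.
rewrite hc /aff /= mulrDr mulr_sumr; congr (_ + _).
by apply: eq_bigr => i _; rewrite mulrA.
Qed.

Lemma affineMr a f : affine f -> affine (fun x => f x * a).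
Proof.
by move=> /(affineZ a)[c hc]; exists c => x; rewrite mulrC hc.
Qed.

Lemma affine_sum (T : Type) (r : seq T) (Q : pred T) (F : T -> (I -> R) -> R) :
  (forall t, affine (F t)) -> affine (fun x => \sum_(t <- r | Q t) F t x).
Proof.
move=> hF; elim: r => [|t r [c hc]].
  by have [c hc] := affine_cst 0; exists c => x; rewrite big_nil -hc.
have [d hd] : affine (fun x => (Q t)%:R * F t x + \sum_(t <- r | Q t) F t x).
  by apply: affineD; [apply: affineZ | exists c].
exists d => x; rewrite big_cons -hd.
by case: (Q t); rewrite ?mul1r // mul0r add0r.
Qed.

Lemma polyhedral_ext P Q :
  (forall x, P x <-> Q x) -> polyhedral P -> polyhedral Q.
Proof. by move=> PQ [cs h]; exists cs => x; rewrite -h PQ. Qed.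

Lemma polyhedral_le f g : affine f -> affine g ->
  polyhedral (fun x => f x <= g x).
Proof.
move=> hf hg; have [c hc] := affineD hf (affineZ (-1) hg).
by exists [:: c] => x; rewrite /= andbT -hc mulN1r subr_le0.
Qed.

Lemma polyhedral_and P Q : polyhedral P -> polyhedral Q ->
  polyhedral (fun x => P x /\ Q x).
Proof.
move=> [cs hP] [ds hQ]; exists (cs ++ ds) => x; rewrite all_cat hP hQ.
by split=> /andP.
Qed.

Lemma polyhedral_eq f g : affine f -> affine g ->
  polyhedral (fun x => f x = g x).
Proof.
move=> hf hg; apply: polyhedral_ext (polyhedral_and (polyhedral_le hf hg)
  (polyhedral_le hg hf)) => x.
by split=> [[]|->//] fg gf; apply/le_anti/andP.
Qed.

Lemma polyhedral_forall (T : finType) (Q : pred T) (P : T -> (I -> R) -> Prop) :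
  (forall t, Q t -> polyhedral (P t)) ->
  polyhedral (fun x => forall t, Q t -> P t x).
Proof.
move=> hP.
suff : forall r : seq T, polyhedral (fun x => forall t, t \in r -> Q t -> P t x).
  move=> /(_ (enum T)); apply: polyhedral_ext => x.
  by split=> h t; [apply: h; rewrite mem_enum | move=> _; apply: h].
elim=> [|t r IH]; first by exists [::] => x; split.
case: (boolP (Q t)) => Qt.
  apply: polyhedral_ext (polyhedral_and (hP t Qt) IH) => x; split.
    by move=> [h1 h2] u; rewrite inE => /orP[/eqP->//|]; apply: h2.
  move=> h; split=> [|u ur]; apply: h => //; rewrite inE ?eqxx //.
  by rewrite ur orbT.
apply: polyhedral_ext IH => x; split=> h u.
  by rewrite inE => /orP[/eqP->|/h//]; rewrite (negbTE Qt).
by move=> ur; apply: h; rewrite inE ur orbT.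
Qed.

Lemma aff_upd c x i s : aff c (upd x i s) = c.1 i * (s - x i) + aff c x.
Proof.
rewrite /aff addrA; congr (_ + _); rewrite (bigD1 i) //= [in RHS](bigD1 i) //=.
rewrite /upd eqxx addrA -mulrDr subrK; congr (_ + _).
by apply: eq_bigr => j /negbTE->.
Qed.

Lemma aff_comb c d (a b : R) x :
  aff (fun i => a * c.1 i + b * d.1 i, a * c.2 + b * d.2) x =
  a * aff c x + b * aff d x.
Proof.
rewrite /aff /= !mulrDr addrACA !mulr_sumr -big_split; congr (_ + _).
by apply: eq_bigr => i _; rewrite mulrDl !mulrA.
Qed.

(** Fourier-Motzkin elimination: constraints free of coordinate [i] stay, and each pair of opposite
    signs at [i] is combined so that [i] cancels. *)
Lemma polyhedral_exists P i : polyhedral P ->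
  polyhedral (fun x => exists s, P (upd x i s)).
Proof.
move=> [cs hP].
pose pos := [seq c <- cs | 0 < c.1 i]; pose neg := [seq c <- cs | c.1 i < 0].
pose comb (p q : (I -> R) * R) := (fun j => p.1 i * q.1 j + - q.1 i * p.1 j,
  p.1 i * q.2 + - q.1 i * p.2).
exists ([seq c <- cs | c.1 i == 0] ++ [seq comb p q | p <- pos, q <- neg]) => x.
transitivity (exists d, all (fun c => c.1 * d + c.2 <= 0)
    [seq (c.1 i, aff c x) | c <- cs]).
  split=> [[s /hP/allP h]|[d /allP h]].
    exists (s - x i); apply/allP => _ /mapP[c ccs ->] /=.
    by rewrite -aff_upd; apply: h.
  exists (x i + d); apply/hP/allP => c ccs.
  rewrite aff_upd [x i + d]addrC addrK.
  by apply: (h (c.1 i, aff c x)); apply/mapP; exists c.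
rewrite fourier_motzkin1 all_cat; split.
  move=> [h0 hpq]; apply/andP; split; apply/allP => c.
    rewrite mem_filter => /andP[/eqP c0 ccs].
    by apply: (h0 (c.1 i, aff c x)) => //; apply/mapP; exists c.
  move=> /allpairsP[[p q] /= []]; rewrite !mem_filter.
  move=> /andP[p0 pcs] /andP[q0 qcs] ->; rewrite aff_comb mulNr.
  apply: (hpq (p.1 i, aff p x) (q.1 i, aff q x)) => //.
    by apply/mapP; exists p.
  by apply/mapP; exists q.
move=> /andP[/allP h0 /allP hpq]; split.
  move=> _ /mapP[c ccs ->] /= c0; apply: h0; rewrite mem_filter ccs.
  by rewrite c0 eqxx.
move=> _ _ /mapP[p pcs ->] /mapP[q qcs ->] /= p0 q0.
rewrite -mulNr -aff_comb; apply: hpq; apply/allpairsP; exists (p, q).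
by rewrite !mem_filter p0 q0.
Qed.

(** Projections along the coordinates in [r] are represented by cylinders, so that the index type
    stays the same during elimination. *)
Definition agree_off (r : seq I) x y := forall i, i \notin r -> x i = y i.

Lemma exists_agree_off_cons P i r x :
  (exists s, exists2 y, P y & agree_off r (upd x i s) y) <->
  exists2 y, P y & agree_off (i :: r) x y.
Proof.
split=> [[s [y Py hy]]|[y Py hy]].
  exists y => // j; rewrite inE negb_or => /andP[ji /hy <-].
  by rewrite /upd (negbTE ji).
exists (y i), y => // j jr; rewrite /upd; case: eqVneq => [->//|ji].
by apply: hy; rewrite inE negb_or ji.
Qed.

Lemma polyhedral_exists_seq P (r : seq I) : polyhedral P ->
  polyhedral (fun x => exists2 y, P y & agree_off r x y).
Proof.
move=> hP; elim: r => [|i r IH].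
  apply: polyhedral_ext hP => x; split=> [Px|[y Py hy]]; first by exists x.
  by rewrite (_ : x = y) //; apply/funext => i; apply: hy.
by apply: polyhedral_ext (polyhedral_exists i IH) => x; apply: exists_agree_off_cons.
Qed.

Lemma polyhedral_line P x i (B : R) : polyhedral P ->
  exists l u, forall s, (l <= s <= u) = (s <= B) && (- B <= s) && `[< P (upd x i s) >].
Proof.
move=> [cs hP].
have [l [u lu]] := clipped_interval (- B - x i) (B - x i)
  [seq (c.1 i, aff c x) | c <- cs].
exists (l + x i), (u + x i) => s.
have := lu (s - x i); rewrite !lerBrDr !lerBlDr !subrK => ->.
rewrite [in RHS](andbC (s <= B)) all_map; congr (_ && _).
have -> : `[< P (upd x i s) >] = all (fun c => aff c (upd x i s) <= 0) cs.
  by apply/asboolP/idP; rewrite hP.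
by apply: eq_all => c /=; rewrite aff_upd.
Qed.

Section Euler.
Variables (T : finType) (V : zmodType) (a : T -> V).

Lemma euler_exists (P : T -> (I -> R) -> Prop) i :
  (forall t, polyhedral (P t)) ->
  (forall x, \sum_t a t *+ `[< P t x >] = 0) ->
  forall x, \sum_t a t *+ `[< exists s, P t (upd x i s) >] = 0.
Proof.
move=> hP h x.
have [|w hw] := @choice _ _ (fun t s =>
    (exists s, P t (upd x i s)) -> P t (upd x i s)).
  move=> t; have [[s hs]|no] := pselect (exists s, P t (upd x i s)).
    by exists s.
  by exists 0.
(* [B] bounds all the chosen witnesses, so clipping the fibres to [-B, B] empties none of the
   nonempty ones. *)
pose B := \sum_t `|w t|.
have wB t : `|w t| <= B.
  by rewrite /B (bigD1 t) //= lerDl sumr_ge0.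
have [|lu hlu] := @choice _ _ (fun t (lu : R * R) => forall s,
    (lu.1 <= s <= lu.2) = (s <= B) && (- B <= s) && `[< P t (upd x i s) >]).
  by move=> t; have [l [u hlu]] := polyhedral_line x i B (hP t); exists (l, u).
rewrite -[RHS](@interval_euler _ _ _ a (fun t => (lu t).1) (fun t => (lu t).2)).
  apply: eq_bigr => t _; congr (_ *+ nat_of_bool _).
  apply/asboolP/idP => [/hw hs|le_lu].
    have := hlu t (w t); have := wB t; rewrite ler_norml => /andP[-> ->].
    by move/asboolP: hs => -> /=; move=> /andP[]; apply: le_trans.
  exists (lu t).1; apply/asboolP; have := hlu t (lu t).1.
  by rewrite lexx le_lu => /esym/andP[].
move=> s; under eq_bigr do rewrite hlu.
case: (_ && _); last by rewrite big1.
exact: h.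
Qed.

(* Eliminating the coordinates one at a time, the relation between the
   indicator functions descends to the images under projection. *)
Lemma polyhedral_euler (P : T -> (I -> R) -> Prop) :
  (forall t, polyhedral (P t)) ->
  (forall x, \sum_t a t *+ `[< P t x >] = 0) ->
  \sum_t a t *+ `[< exists x, P t x >] = 0.
Proof.
move=> hP h; suff hr r : forall x,
    \sum_t a t *+ `[< exists2 y, P t y & agree_off r x y >] = 0.
  rewrite -[RHS](hr (enum I) (fun=> 0)); apply: eq_bigr => t _.
  congr (_ *+ nat_of_bool _); apply/asbool_equiv_eq.
  by split=> [[x Px]|[x Px _]]; exists x => // i; rewrite mem_enum.
elim: r => [|i r IH] x.
  rewrite -[RHS](h x); apply: eq_bigr => t _; congr (_ *+ nat_of_bool _).
  apply/asbool_equiv_eq; split=> [[y Py hy]|Px]; last by exists x.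
  by rewrite (_ : x = y) //; apply/funext => i; apply: hy.
have hPr t := polyhedral_exists_seq r (hP t).
rewrite -[RHS](euler_exists i hPr IH x); apply: eq_bigr => t _.
congr (_ *+ nat_of_bool _); apply/asbool_equiv_eq.
by rewrite exists_agree_off_cons.
Qed.

End Euler.
End Polyhedra.

(** * Faces of matroid polytopes and valuations from rank conditions *)

Section Polytopes.
Variables (R : realType) (E : finType).
Implicit Types (M N : matroid E) (B : {set E}) (c x : {ffun E -> R}).

Lemma dotp_conv c x (D : {set {set E}}) (w : {set E} -> R) :
  (forall i, x i = \sum_(B in D) w B * indicator R B i) ->
  dotp c x = \sum_(B in D) w B * dotp c (indicator R B).
Proof.
move=> hx; rewrite /dotp (eq_bigr (fun i =>
  \sum_(B in D) w B * (c i * indicator R B i))); last first.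
  by move=> i _; rewrite hx mulr_sumr; apply: eq_bigr => B _; rewrite mulrCA.
by rewrite exchange_big; apply: eq_bigr => B _; rewrite mulr_sumr.
Qed.

Lemma dotp_indicator c B : dotp c (indicator R B) = \sum_(i in B) c i.
Proof.
rewrite /dotp [RHS]big_mkcond; apply: eq_bigr => i _; rewrite ffunE.
by case: (i \in B); rewrite ?mulr1 ?mulr0.
Qed.

Lemma dotp_indicators S B :
  dotp (indicator R S) (indicator R B) = #|B :&: S|%:R.
Proof.
rewrite dotp_indicator -sum1_card natr_sum [LHS]big_mkcond [RHS]big_mkcond.
by apply: eq_bigr => i _; rewrite ffunE inE; case: (i \in B); case: (i \in S).
Qed.

Lemma dotp_exchange c B i j : i \in B -> j \notin B ->
  dotp c (indicator R (j |: (B :\ i))) = dotp c (indicator R B) - c i + c j.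
Proof.
move=> iB jB; rewrite !dotp_indicator big_setU1 ?inE ?(negbTE jB) ?andbF //=.
by rewrite [in RHS](big_setD1 i) //= addrC [c i + _]addrC addrK.
Qed.

(** The bases on the face are those of weight [b]. Symmetric exchange between two of them changes
    the weights by opposite amounts, and validity forces both changes to vanish. *)
Lemma face_matroid_polytope M c (b : R) :
  (forall x, matroid_polytope M x -> dotp c x <= b) ->
  (matroid_polytope M `&` [set x | dotp c x = b] !=set0)%classic ->
  exists N, (matroid_polytope M `&` [set x | dotp c x = b])%classic =
            matroid_polytope N.
Proof.
move=> valid [x0 [Mx0 cx0]].
have validB B : B \in bases M -> dotp c (indicator R B) <= b.
  by move=> BM; apply/valid/indicator_polytope.
pose D := [set B in bases M | dotp c (indicator R B) == b].
(* Complementary slackness: a convex combination attaining the bound [b] puts weight only on bases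
   attaining it. *)
have supp x w : (forall B, B \in bases M -> 0 <= w B) ->
    \sum_(B in bases M) w B = 1 ->
    (forall i, x i = \sum_(B in bases M) w B * indicator R B i) ->
    dotp c x = b -> forall B, B \in bases M -> B \notin D -> w B = 0.
  move=> w0 w1 hx cx.
  have : \sum_(B in bases M) w B * (b - dotp c (indicator R B)) = 0.
    under eq_bigr do rewrite mulrBr.
    by rewrite sumrB -mulr_suml w1 -(dotp_conv _ hx) cx mul1r subrr.
  move=> /psumr_eq0P h B BM; rewrite inE BM /= => cB.
  have /eqP : w B * (b - dotp c (indicator R B)) = 0.
    by apply: h => // C CM; rewrite mulr_ge0 ?w0 // subr_ge0 validB.
  by rewrite mulf_eq0 subr_eq0 [b == _]eq_sym (negbTE cB) orbF => /eqP.
have D_gt0 : (0 < #|D|)%N.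
  rewrite lt0n; apply/eqP => /cards0_eq D0.
  have [w [w0 w1 hx]] := Mx0; have := w1; rewrite big1 => [/esym/eqP|B BM].
    by rewrite oner_eq0.
  by apply: (supp _ w w0 w1 hx cx0) => //; rewrite D0 inE.
have Dexch : [forall B1 in D, forall B2 in D, forall x in B1 :\: B2,
    exists y in B2 :\: B1, (y |: (B1 :\ x))%SET \in D].
  apply/forall_inP => B1 /[!inE] /andP[h1 /eqP c1].
  apply/forall_inP => B2 /[!inE] /andP[h2 /eqP c2].
  apply/forall_inP => i hi; have [j [hj h1' h2']] := symmetric_exchange h1 h2 hi.
  apply/exists_inP; exists j => //; rewrite inE h1' /=; apply/eqP.
  have := validB _ h1'; have := validB _ h2'.
  move: hi hj; rewrite !inE => /andP[iB2 iB1] /andP[jB1 jB2].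
  by rewrite !dotp_exchange // c1 c2; lra.
exists (Matroid D_gt0 Dexch); apply/seteqP; split=> x.
  move=> [[w [w0 w1 hx]] /= cx]; have w_out := supp x w w0 w1 hx cx.
  have restr F : \sum_(B in bases M) w B * F B = \sum_(B in D) w B * F B.
    rewrite (bigID (mem D)) /= [X in _ + X]big1 ?addr0 => [|B /andP[BM BD]].
      by apply: eq_bigl => B; rewrite inE andbA andbb.
    by rewrite w_out ?mul0r.
  exists w; split=> [B /[!inE] /andP[BM _]||i]; first exact: w0.
    transitivity (\sum_(B in D) w B * 1).
      by apply: eq_bigr => B _; rewrite mulr1.
    by rewrite -(restr (fun=> 1)) -[RHS]w1; apply: eq_bigr => B _; rewrite mulr1.
  by rewrite hx restr.
move=> [w [w0 w1 hx]] /=; split.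
  exists (fun B => if B \in D then w B else 0).
  have restr F : \sum_(B in bases M) (if B \in D then w B else 0) * F B =
      \sum_(B in D) w B * F B.
    rewrite big_mkcond [RHS]big_mkcond; apply: eq_bigr => B _.
    by rewrite !inE; case: (B \in bases M) => //=; case: ifP; rewrite ?mul0r.
  split=> [B BM||i]; first by case: ifP => // /w0.
    transitivity (\sum_(B in bases M) (if B \in D then w B else 0) * 1).
      by apply: eq_bigr => B _; rewrite mulr1.
    by rewrite (restr (fun=> 1)) -[RHS]w1; apply: eq_bigr => B _; rewrite mulr1.
  by rewrite hx restr.
rewrite (dotp_conv c hx) -[RHS]mul1r -w1 mulr_suml.
by apply: eq_bigr => B; rewrite inE => /andP[_ /eqP->].
Qed.

(** Pieces are intersected one at a time. The inequality cutting the common face with [N j] out of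
    [N i] stays valid on the smaller intersection, and cuts a face out of it. *)
Lemma meet_faces_matroid_polytope s (N : 'I_s -> matroid E) (i : 'I_s)
    (r : seq 'I_s) :
  (forall j, i <> j ->
     (matroid_polytope (R := R) (N i) `&` matroid_polytope (N j) !=set0)%classic ->
     is_face (matroid_polytope (R := R) (N i) `&` matroid_polytope (N j))%classic
       (matroid_polytope (N i))) ->
  let X := [set x : {ffun E -> R} | matroid_polytope (N i) x /\
                    forall j, j \in r -> matroid_polytope (N j) x]%classic in
  X = set0%classic \/ exists N', X = matroid_polytope N'.
Proof.
move=> hface; elim: r => [|j r /= IH] /=.
  by right; exists (N i); apply/seteqP; split=> [x []|x].
set X := [set x | _]%classic in IH; set Y := [set x | _]%classic.
have XY : Y = (X `&` matroid_polytope (N j))%classic.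
  apply/seteqP; split=> x /=.
    move=> [xi h]; split; last by apply: h; rewrite inE eqxx.
    by split=> // l lr; apply: h; rewrite inE lr orbT.
  move=> [[xi h] xj]; split=> // l; rewrite inE => /orP[/eqP->//|]; exact: h.
have [|nY0] := pselect (Y = set0%classic); [by left | right].
have Y0 : (Y !=set0)%classic.
  apply: contrapT => h; apply: nY0; apply/seteqP; split=> // x Yx.
  by apply: h; exists x.
have Xi x : X x -> matroid_polytope (N i) x by case.
have [ij|nij] := pselect (i = j).
  have -> : Y = X.
    by rewrite XY -ij; apply/seteqP; split=> [x []|x Xx] //; split=> //; apply: Xi.
  case: IH => [X0|[N' XN']]; last by exists N'.
  by case: Y0 => x; rewrite XY X0 => -[].
case: IH => [X0|[N' XN']]; first by case: Y0 => x; rewrite XY X0 => -[].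
have [|c [b [valid eF]]] := hface j nij.
  by case: Y0 => x; rewrite XY => -[/Xi xi xj]; exists x.
have eY : Y = (matroid_polytope N' `&` [set x | dotp c x = b])%classic.
  rewrite XY -XN'; apply/seteqP; split=> x [Xx xj]; split=> //.
    have : (matroid_polytope (N i) `&` matroid_polytope (N j))%classic x.
      by split=> //; apply: Xi.
    by rewrite eF => -[].
  have : (matroid_polytope (N i) `&` [set x | dotp c x = b])%classic x.
    by split=> //; apply: Xi.
  by rewrite -eF => -[].
rewrite eY; apply: face_matroid_polytope; last by rewrite -eY.
by move=> x; rewrite -XN' => /Xi; apply: valid.
Qed.

(** The extra coordinates [inr B] carry the convex weights: points with their weights form a
    polyhedron, and projecting the weights away leaves the polytope. *)
Lemma polyhedral_matroid_polytope N :
  polyhedral (fun y : E + {set E} -> R =>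
                matroid_polytope N [ffun e => y (inl e)]).
Proof.
have aff_w F : affine (fun y : E + {set E} -> R =>
    \sum_(B in bases N) y (inr B) * F B).
  apply: (affine_sum _ _ (F := fun B y => y (inr B) * F B)) => B.
  by apply/affineMr/affine_coord.
have h0 : polyhedral (fun y : E + {set E} -> R =>
    forall B, B \in bases N -> 0 <= y (inr B)).
  apply: polyhedral_forall => B _.
  by apply: polyhedral_le; [apply: affine_cst | apply: affine_coord].
have h1 : polyhedral (fun y : E + {set E} -> R =>
    \sum_(B in bases N) y (inr B) * 1 = 1).
  by apply: polyhedral_eq; [apply: aff_w | apply: affine_cst].
have hx : polyhedral (fun y : E + {set E} -> R => forall e : E, predT e ->
    y (inl e) = \sum_(B in bases N) y (inr B) * indicator R B e).
  apply: polyhedral_forall => e _.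
  by apply: polyhedral_eq; [apply: affine_coord | apply: aff_w].
have hP := polyhedral_and h0 (polyhedral_and h1 hx).
pose r : seq (E + {set E}) := [seq inr B | B : {set E}].
apply: polyhedral_ext (polyhedral_exists_seq r hP) => y.
have inl_out e : inl e \notin r by apply/mapP => -[].
split=> [[z [z0 [z1 hz]] yz]|[w [w0 w1 hw]]].
  exists (fun B => z (inr B)); split=> // [|e].
    by rewrite -[RHS]z1; apply: eq_bigr => B _; rewrite mulr1.
  by rewrite ffunE yz ?hz.
exists (fun i => match i with inl e => y (inl e) | inr B => w B end).
  split=> //; split=> [|e _]; last by rewrite -hw ffunE.
  by rewrite -[RHS]w1; apply: eq_bigr => B _; rewrite mulr1.
case=> // B /negP[].
by apply/mapP; exists B; rewrite ?mem_enum.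
Qed.

Definition meets_rank_bounds k (S : {ffun 'I_k -> {set E}}) (rho : 'I_k -> nat)
    (X : set {ffun E -> R}) : Prop :=
  exists2 x, X x & forall i, (rho i)%:R <= dotp (indicator R (S i)) x.

(** A point of the polytope averages bases, none of which exceeds the ranks. Conversely, along a
    chain [chain_basis] supplies one vertex attaining all ranks together. *)
Lemma meets_rank_boundsP k (S : {ffun 'I_k -> {set E}}) (rho : 'I_k -> nat) N :
  is_chain S ->
  meets_rank_bounds S rho (matroid_polytope N) <->
  forall i, (rho i <= rk N (S i))%N.
Proof.
move=> Schain; split=> [[x [w [w0 w1 hx]] xS] i|h].
  rewrite -(ler_nat R) (le_trans (xS i)) // (dotp_conv _ hx).
  have -> : (rk N (S i))%:R = \sum_(B in bases N) w B * (rk N (S i))%:R.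
    by rewrite -mulr_suml w1 mul1r.
  apply: ler_sum => B BN.
  by rewrite ler_wpM2l ?w0 // dotp_indicators ler_nat rk_leq.
have [B BN rB] := chain_basis N Schain.
exists (indicator R B); first exact/indicator_polytope.
by move=> i; rewrite dotp_indicators ler_nat rB.
Qed.

Lemma prod_one_minus_indicators (A : comPzRingType) s (p : pred 'I_s) :
  \prod_(j < s) (1 - (p j)%:R) =
  \sum_(J : {set 'I_s}) (-1) ^+ #|J| *+ (J \subset p) :> A.
Proof.
rewrite (eq_bigr (fun j => - (p j)%:R + 1)); last by move=> j _; rewrite addrC.
rewrite bigA_distr; apply: eq_bigr => J _.
rewrite -big_mkcond /= prodrN -[RHS]mulr_natr; congr (_ * _).
have [/fintype.subsetP Jp|/fintype.subsetPn[j jJ jp]] := boolP (J \subset p).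
  by rewrite big1 // => j /Jp; rewrite unfold_in => ->.
by rewrite (bigD1 j) //= (_ : p j = false) ?mul0r //; apply/negbTE.
Qed.

(** At each point of [M] the product of the factors [1 - [x in N j]] vanishes, since some piece
    contains the point. Its expansion is a pointwise relation, which [polyhedral_euler] carries over
    to nonemptiness. *)
Lemma subdivision_euler (A : comPzRingType) M s (N : 'I_s -> matroid E)
    k (S : {ffun 'I_k -> {set E}}) (rho : 'I_k -> nat) :
  matroid_polytope (R := R) M = (\bigcup_i matroid_polytope (N i))%classic ->
  \sum_(J : {set 'I_s}) (-1) ^+ #|J| *+ `[< meets_rank_bounds S rho
    (matroid_polytope M `&` \bigcap_(j in [set` J]) matroid_polytope (N j))%classic >]
  = 0 :> A.
Proof.
move=> eM.
pose ext (y : E + {set E} -> R) : {ffun E -> R} := [ffun e => y (inl e)].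
pose Q (y : E + {set E} -> R) := forall i, predT i ->
  (rho i)%:R <= \sum_e indicator R (S i) e * y (inl e).
pose P (J : {set 'I_s}) y := (matroid_polytope M (ext y) /\ Q y) /\
  forall j, j \in J -> matroid_polytope (N j) (ext y).
have hP J : polyhedral (P J).
  apply: polyhedral_and; last first.
    by apply: polyhedral_forall => j _; apply: polyhedral_matroid_polytope.
  apply: polyhedral_and; first exact: polyhedral_matroid_polytope.
  apply: polyhedral_forall => i _; apply: polyhedral_le; first exact: affine_cst.
  apply: (affine_sum _ _ (F := fun e y => indicator R (S i) e * y (inl e))) => e;
  by apply/affineZ/affine_coord.
rewrite -[RHS](polyhedral_euler hP (a := fun J : {set 'I_s} => (-1) ^+ #|J|)) => [|y].
  apply: eq_bigr => J _; congr (_ *+ nat_of_bool _); apply/asbool_equiv_eq.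
  split=> [[x [Mx Jx] xS]|[y [[My Qy] Jy]]].
    exists (fun i => if i is inl e then x e else 0).
    have -> : P J (fun i => if i is inl e then x e else 0) =
      ((matroid_polytope M x /\ Q (fun i => if i is inl e then x e else 0)) /\
      forall j, j \in J -> matroid_polytope (N j) x).
      by rewrite /P (_ : ext _ = x) //; apply/ffunP => e; rewrite ffunE.
    by split; [split=> // i _; apply: xS | move=> j jJ; apply: Jx].
  exists (ext y); first by split=> // j jJ; apply: Jy.
  move=> i; rewrite (le_trans (Qy i isT)) // /dotp.
  by apply: ler_sum => e _; rewrite [ext y e]ffunE.
have [MQ|nMQ] := pselect (matroid_polytope M (ext y) /\ Q y); last first.
  by rewrite big1 // => J _; rewrite asboolF // => -[MQ _]; apply: nMQ.
pose p := [pred j : 'I_s | `[< matroid_polytope (N j) (ext y) >]].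
rewrite (eq_bigr (fun J : {set 'I_s} => (-1) ^+ #|J| *+ (J \subset p))).
  rewrite -prod_one_minus_indicators.
  have [+ _] := MQ; rewrite eM => -[j _ yj].
  by rewrite (bigD1 j) //= asboolT // subrr mul0r.
move=> J _; congr (_ *+ nat_of_bool _); apply/asboolP/fintype.subsetP.
  by move=> [_ h] j /h hj; rewrite inE.
by move=> h; split=> // j /h; rewrite inE.
Qed.

(** The expansion extends [f] to a function [F] of arbitrary point sets that vanishes on the empty
    set, so [subdivision_euler] applies termwise. It is asked only for matroids with bases among
    those of [M], so [q] may depend on [M]. *)
Lemma valuation_of_rank_expansion (A : comPzRingType) (f : matroid E -> A)
    M s (N : 'I_s -> matroid E) k (T : finType)
    (S : T -> {ffun 'I_k -> {set E}}) (rho : T -> 'I_k -> nat) (q : T -> A) :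
  is_matroid_subdivision R M N ->
  (forall N', bases N' \subset bases M -> f N' =
     \sum_t q t *+ `[< meets_rank_bounds (S t) (rho t) (matroid_polytope N') >]) ->
  f M = \sum_(J : {set 'I_s} | (0 < #|J|)%N)
          (-1) ^+ (#|J| - 1) *
          on_polytope f (\bigcap_(j in [set` J]) matroid_polytope (R := R) (N j)).
Proof.
move=> [eM _ hface] hf.
pose F X := \sum_t q t *+ `[< meets_rank_bounds (S t) (rho t) X >].
pose K (J : {set 'I_s}) :=
  (matroid_polytope M `&` \bigcap_(j in [set` J]) matroid_polytope (R := R) (N j))%classic.
have sub_bases N' : (matroid_polytope N' `<=` matroid_polytope (R := R) M)%classic ->
    bases N' \subset bases M.
  by move=> h; apply/fintype.subsetP => B /(indicator_polytope R)/h/indicator_polytope.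
have FK : \sum_(J : {set 'I_s}) (-1) ^+ #|J| * F (K J) = 0.
  rewrite /F; under eq_bigr do rewrite mulr_sumr.
  rewrite exchange_big big1 //= => t _.
  rewrite (eq_bigr (fun J : {set 'I_s} => q t * ((-1) ^+ #|J| *+
    `[< meets_rank_bounds (S t) (rho t) (K J) >]))).
    by rewrite -mulr_sumr subdivision_euler ?mulr0.
  by move=> J _; rewrite mulrnAr mulrC -mulrnAr.
have K0 : K finset.set0 = matroid_polytope M.
  apply/seteqP; split=> [x []|x Mx] //.
  by split=> // j /=; rewrite finset.in_set0.
have KJ (J : {set 'I_s}) : (0 < #|J|)%N ->
    F (K J) = on_polytope f (\bigcap_(j in [set` J]) matroid_polytope (R := R) (N j)).
  move=> /card_gt0P[i iJ].
  have Ni_sub x : matroid_polytope (N i) x -> matroid_polytope (R := R) M x.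
    by rewrite eM => xi; exists i.
  have -> : (\bigcap_(j in [set` J]) matroid_polytope (R := R) (N j))%classic = K J.
    apply/seteqP; split=> x; last by case.
    by move=> h; split=> //; apply: Ni_sub; apply: h.
  have KE : K J = [set x : {ffun E -> R} | matroid_polytope (N i) x /\
      forall j, j \in enum J -> matroid_polytope (N j) x]%classic.
    apply/seteqP; split=> x.
      move=> [_ h]; split; first exact: h.
      by move=> j; rewrite mem_enum; apply: h.
    move=> [xi h]; split; first exact: Ni_sub.
    by move=> j jJ; apply: h; rewrite mem_enum.
  have [|K_0|[N' KN']] := @meet_faces_matroid_polytope s N i (enum J).
  - by move=> j ij F0; have [[]] := hface i j ij F0.
  - rewrite KE K_0 on_polytope0 /F big1 // => t _.
    by rewrite asboolF // => -[].
  rewrite KE KN' on_polytopeE hf //; apply: sub_bases => x.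
  by rewrite -KN' => -[/Ni_sub].
transitivity (F (K finset.set0)); first by rewrite K0 hf.
(* The term of the empty [J] is [F] at the polytope of [M]; moving the others across shifts each
   sign exponent to [#|J| - 1]. *)
move: FK; rewrite (bigD1 finset.set0) //= finset.cards0 expr0 mul1r => /eqP.
rewrite addr_eq0 => /eqP ->; rewrite -sumrN.
apply: eq_big => [J|J]; rewrite -finset.card_gt0 // => J0.
by rewrite -KJ // -mulNr -[in LHS](prednK J0) -subn1 exprS mulN1r opprK.
Qed.

End Polytopes.

(** * Expansion of the chain Whitney polynomial into rank conditions *)

Section Whitney.

(** Backward difference with the convention p(-1) = 0. *)
Definition increment (A : zmodType) (p : nat -> A) (j : nat) : A :=
  if j is j'.+1 then p j - p j' else p 0%N.

Lemma telescope_threshold (A : zmodType) (p : nat -> A) n m : (m <= n)%N ->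
  p m = \sum_(j < n.+1) increment p j *+ (j <= m)%N.
Proof.
move=> lemn; transitivity (\sum_(j < m.+1) increment p j).
  elim: m {lemn} => [|m IH]; first by rewrite big_ord1.
  by rewrite big_ord_recr /= -IH addrC subrK.
rewrite (big_ord_widen n.+1 (increment p)) ?ltnS // big_mkcond.
by apply: eq_bigr => j _; rewrite ltnS; case: leqP.
Qed.

Lemma prod_threshold (A : comPzRingType) k (F : 'I_k -> A) (b : 'I_k -> bool) :
  \prod_i (F i *+ b i) = (\prod_i F i) *+ [forall i, b i].
Proof.
have [/forallP h|/forallPn[i /negbTE bi]] := boolP [forall i, b i].
  by apply: eq_bigr => i _; rewrite h.
by rewrite (bigD1 i) //= bi mul0r.
Qed.

(** Bases of [N] are bases of [M], so both have the same total rank and the coefficients can be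
    fixed from [M] alone. Each factor telescopes over thresholds, and distributing the product
    yields the sum over [rho]. *)
Lemma chain_whitney_expansion (R : realType) k (E : finType) (M : matroid E) :
  exists (q : {ffun 'I_k -> {set E}} * {ffun 'I_k -> 'I_#|E|.+1} ->
              {mpoly int[k + k]}),
  forall N, bases N \subset bases M -> chain_whitney k N =
    \sum_t q t *+ `[< meets_rank_bounds t.1 (fun i => t.2 i : nat)
                       (matroid_polytope (R := R) N) >].
Proof.
(* The [i]-th factor of the Whitney term, with the rank of [S i] replaced by a free parameter
   [m]. *)
pose p (S : {ffun 'I_k -> {set E}}) i m : {mpoly int[k + k]} :=
  'X_(lshift k i) ^+ (rk M [set: E] - m) * 'X_(rshift k i) ^+ (#|S i| - m).
exists (fun t : _ * {ffun 'I_k -> 'I_#|E|.+1} =>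
  if is_chain t.1 then \prod_i increment (p t.1 i) (t.2 i) else 0) => N NM.
have rkE : rk N [set: E] = rk M [set: E].
  have /card_gt0P[B BN] := bases_nonempty N.
  by rewrite (rk_setT BN) (rk_setT (fintype.subsetP NM B BN)).
rewrite /chain_whitney big_mkcond.
rewrite -(pair_bigA _ (fun S (rho : {ffun 'I_k -> 'I_#|E|.+1}) => (if is_chain S then
  \prod_i increment (p S i) (rho i) else 0) *+ `[< meets_rank_bounds S
    (fun i => rho i : nat) (matroid_polytope (R := R) N) >])) /=.
apply: eq_bigr => S _; case: ifP => Schain; last first.
  by rewrite big1 // => rho _; rewrite mul0rn.
rewrite (eq_bigr (fun i => \sum_(j < #|E|.+1) increment (p S i) j *+ (j <= rk N (S i))%N)).
  rewrite bigA_distr_bigA; apply: eq_bigr => rho _.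
  rewrite prod_threshold; congr (_ *+ nat_of_bool _).
  by apply/forallP/asboolP; rewrite meets_rank_boundsP.
move=> i _; rewrite rkE -/(p S i _); apply: telescope_threshold.
by rewrite (leq_trans (rk_card _ _)) ?max_card.
Qed.

Lemma valuation_rmorphism (R : realType) (A A' : comPzRingType)
    (phi : {rmorphism A -> A'}) (f : forall E : finType, matroid E -> A) :
  is_matroid_valuation R f -> is_matroid_valuation R (fun E M => phi (f E M)).
Proof.
move=> hf E M s N hN; rewrite (hf E M s N hN) rmorph_sum.
apply: eq_bigr => J _; rewrite rmorphM rmorphXn rmorphN1; congr (_ * _).
by rewrite /on_polytope; case: pselect => // ?; rewrite rmorph0.
Qed.

End Whitney.

Theorem theorem4p8 (R : realType) (k : nat) (hk : (0 < k)%N) :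
  is_matroid_valuation R (fun (E : finType) (M : matroid E) => chain_whitney k M) /\
  is_matroid_valuation R (fun (E : finType) (M : matroid E) => chain_tutte k M).
Proof.
have hW : is_matroid_valuation R
    (fun (E : finType) (M : matroid E) => chain_whitney k M).
  move=> E M s N hN; have [q hq] := chain_whitney_expansion R k M.
  exact: valuation_of_rank_expansion hN hq.
by split=> //; apply: (valuation_rmorphism (comp_mpoly _) hW).
Qed.
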